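(* Let $(\Omega,d)$ be a separable metric space and let $\operatorname{diam}(\Omega)=\sup\{d(x,y):x,y\in\Omega\}$. For all Borel probability measures $\mu,\nu$ on $\Omega$, $$d_W(\mu,\nu)\le\operatorname{diam}(\Omega)\cdot d_{TV}(\mu,\nu).$$ Moreover, if $\Omega$ is a finite set (with at least two points) and $d_{\min}=\min_{x\ne y}d(x,y)$, the minimum being over pairs of distinct points of $\Omega$, then for all probability measures $\mu,\nu$ on $\Omega$, $$d_{\min}\cdot d_{TV}(\mu,\nu)\le d_W(\mu,\nu).$$
   Context: A metric space is regarded as a measurable space with its Borel $\sigma$-algebra. The total variation distance is $d_{TV}(\mu,\nu)=\sup_A|\mu(A)-\nu(A)|$, the supremum over all measurable sets $A\subseteq\Omega$ (so it takes values in $[0,1]$; on a countable space it is $\frac12\sum_x|\mu(x)-\nu(x)|$). The Wasserstein (Kantorovich) metric is $d_W(\mu,\nu)=\inf_J\mathbf{E}_J[d(X,Y)]$, the infimum being over all joint distributions $J$ of pairs $(X,Y)$ of $\Omega$-valued random variables with marginal laws $\mu$ and $\nu$. By the Kantorovich–Rubinstein theorem this equals $\sup\{|\int h\,d\mu-\int h\,d\nu|:|h(x)-h(y)|\le d(x,y)\ \forall x,y\in\Omega\}$, the paper's equivalent definition. If $\operatorname{diam}(\Omega)=\infty$, the first inequality carries no information (its right side is read as $\infty$). *)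

(* Defs.v *)
From HB Require Import structures.
From mathcomp Require Import all_boot all_order all_algebra.
From mathcomp Require Import all_classical all_reals all_analysis.

Set Implicit Arguments.
Unset Strict Implicit.
Unset Printing Implicit Defensive.

Import Order.TTheory GRing.Theory Num.Theory.
Import numFieldNormedType.Exports.

Local Open Scope classical_set_scope.
Local Open Scope ring_scope.
Local Open Scope ereal_scope.

(* Measurable types are pointed in the library, hence this join.  It loses
   nothing: a space carrying a probability measure is nonempty. *)
#[short(type="pmetricType")]
HB.structure Definition PointedMetric (K : numDomainType) :=
  { M of Metric K M & Pointed M }.

Definition separable_space (T : topologicalType) : Prop :=
  exists2 D : set T, countable D & dense D.

Definition borel (T : ptopologicalType) := g_sigma_algebraType (@open T).

Section distances.
Context {R : realType} {T : pmetricType R}.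
Implicit Types mu nu : probability (borel T) R.

Definition total_variation_dist mu nu : \bar R :=
  ereal_sup [set `|mu A - nu A| | A in (measurable : set (set (borel T)))].

(* The marginals are compared on measurable sets only, because the values of a
   measure outside the sigma-algebra are unspecified. *)
Definition coupling mu nu : set (probability (borel T * borel T)%type R) :=
  [set J | forall A : set (borel T), measurable A ->
     pushforward J fst A = mu A /\ pushforward J snd A = nu A].

Definition wasserstein_dist mu nu : \bar R :=
  ereal_inf [set 'E_J[fun z => mdist (z.1 : T) (z.2 : T)] | J in coupling mu nu].

End distances.

Definition diam {R : realType} (T : metricType R) : \bar R :=
  ereal_sup [set (mdist xy.1 xy.2)%:E | xy in [set: T * T]].

Definition min_dist {R : realType} (T : metricType R) : \bar R :=
  ereal_inf [set (mdist xy.1 xy.2)%:E | xy in [set xy : T * T | xy.1 <> xy.2]].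

(* Main.v *)
Require Import Defs.
From HB Require Import structures.
From mathcomp Require Import all_boot all_order all_algebra.
From mathcomp Require Import all_classical all_reals all_analysis.
From mathcomp Require Import measurable_realfun lra.
Import Order.TTheory GRing.Theory Num.Theory.
Import numFieldNormedType.Exports.

Local Open Scope classical_set_scope.
Local Open Scope ring_scope.
Local Open Scope ereal_scope.

(** The upper bound comes from a maximal coupling.  A Hahn decomposition
    [(P, N)] of the charge [mu - nu] gives a common part [m], equal to [nu] on
    [P] and to [mu] on [N], together with an excess [alpha] and a deficit
    [beta], such that [mu = m + alpha] and [nu = m + beta]; the measures
    [alpha] and [beta] have the same total mass [t = mu P - nu P].  Put [m] on
    the diagonal and add the product of [alpha] and [beta] divided by [t]: the
    marginals are [mu] and [nu].  The distance vanishes on the diagonal and is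
    at most the diameter elsewhere, so its expectation is at most the diameter
    times [t] ([maximal_coupling_integral_le]), and [t] is at most the total
    variation distance.

    For the lower bound, let [J] be any coupling and [A] a measurable set.
    The marginals of [J] can only differ on [A] through pairs with exactly one
    coordinate in [A] ([marginal_gap_le]).  The coordinates of such a pair are
    distinct, hence at distance at least [min_dist T], and integrating gives
    [min_dist T * `|mu A - nu A| <= 'E_J[d]] ([min_dist_measure_le]).

    Both arguments integrate the distance against a measure on the product
    sigma-algebra.  Separability is what makes the distance measurable for
    it ([measurable_mdist]). *)

(** * Measurability of the distance *)

Lemma separable_dense_sequence (T : ptopologicalType) :
  separable_space T ->
  exists q : nat -> T,
    forall O : set T, O !=set0 -> open O -> exists n, O (q n).
Proof.
move=> [D cD dD].
have [x [_ Dx]] : ([set: T] `&` D) !=set0.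
  by apply: dD; [exists point | exact: openT].
have /pfcard_geP[D0|[q]] : (D #<= [set: nat])%card by exact: cD.
  by rewrite D0 in Dx.
exists q => O O0 oO; have [y [Oy Dy]] := dD O O0 oO.
have [n _ qny] : (q @` [set: nat]) y by rewrite image_eq.
by exists n; rewrite qny.
Qed.

Lemma open_metric_ball {R : realFieldType} {T : metricType R} (x : T) (r : R) :
  open (ball x r).
Proof.
rewrite openE => y; rewrite ballEmdist/= => xyr.
apply/nbhs_ballP; exists (r - mdist x y)%R; first by rewrite /= subr_gt0.
move=> z; rewrite !ballEmdist/= ltrBrDl; apply: le_lt_trans.
exact: metric_triangle.
Qed.

Section metric_borel.
Context {R : realType} {T : pmetricType R}.

Lemma measurable_metric_ball (x : T) (r : R) :
  measurable (ball x r : set (borel T)).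
Proof. by apply: sub_sigma_algebra; exact: open_metric_ball. Qed.

(** By the triangle inequality, [d x y < r] holds iff some [q n] of a dense
    sequence and some rational [s] satisfy [d (q n) x < s] and
    [d (q n) y < r - s].  A strict sublevel set of the distance is therefore a
    countable union of rectangles. *)
Lemma measurable_mdist : separable_space T ->
  measurable_fun [set: borel T * borel T]
    (fun z => mdist (z.1 : T) (z.2 : T)).
Proof.
move=> /separable_dense_sequence[q dq] _.
apply: (measurability _ (RGenInftyO.measurableE R)) => //.
move=> _ [_ [r ->] <-]; rewrite setTI.
rewrite (_ : _ @^-1` _ = \bigcup_n \bigcup_(s : rat)
    ((ball (q n) (ratr s) : set (borel T)) `*`
     (ball (q n) (r - ratr s)%R : set (borel T)))).
  apply: bigcupT_measurable => n; apply: bigcupT_measurable_rat => s.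
  by apply: measurableX; exact: measurable_metric_ball.
apply/seteqP; split => [[x y]/=|[x y] [n _ [s _]]]; rewrite /= ?in_itv/=.
  move=> xyr.
  (* With [d x (q n) < e], the triangle inequality gives
     [d (q n) x + d (q n) y < 2 * e + d x y = r], which leaves room for [s]. *)
  pose e := ((r - mdist (x : T) y) / 2)%R.
  have e0 : (0 < e)%R by rewrite divr_gt0// subr_gt0.
  have [||n] := dq (ball (x : T) e).
  - by exists x; exact: (ball_center _ (PosNum e0)).
  - exact: open_metric_ball.
  rewrite ballEmdist/= metric_sym => xq.
  have [|s] := @rat_in_itvoo R (mdist (q n) x) (r - mdist (q n) y)%R.
    have := metric_triangle (q n) x y.
    by move: xq; rewrite /e; lra.
  rewrite in_itv/= => /andP[xs sy].
  exists n => //; exists s => //=; rewrite !ballEmdist/=; split => //.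
  by move: sy; lra.
rewrite !ballEmdist/= => -[sx sy].
have := metric_triangle (x : T) (q n) y.
by rewrite (metric_sym x (q n)); lra.
Qed.

End metric_borel.

(** * Maximal couplings *)

Section maximal_coupling.
Context {d} {X : measurableType d} {R : realType} {mu nu : probability X R}.

Let diff : {charge set X -> \bar R} :=
  cadd (charge_of_finite_measure mu) (copp (charge_of_finite_measure nu)).

Context {P N : set X} (diffPN : hahn_decomposition diff P N).

Let mP : measurable P. Proof. by case: diffPN => -[]. Qed.
Let mN : measurable N. Proof. by case: diffPN => _ []. Qed.

(** The infimum of [mu] and [nu]: it is [nu] on [P], where [nu <= mu], and
    [mu] on [N], where [mu <= nu]. *)
Definition common_part : set X -> \bar R :=
  measure_add (mrestr nu mP) (mrestr mu mN).
HB.instance Definition _ := Measure.on common_part.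

(** The positive part of [mu - nu], that is, [mu - common_part]. *)
Definition excess : set X -> \bar R := jordan_pos diffPN.
HB.instance Definition _ := FiniteMeasure.on excess.

(** The negative part of [mu - nu], that is, [nu - common_part]. *)
Definition deficit : set X -> \bar R := jordan_neg diffPN.
HB.instance Definition _ := FiniteMeasure.on deficit.

Let excessE A : measurable A -> excess A = mu (A `&` P) - nu (A `&` P).
Proof.
by move=> mA; rewrite /excess jordan_posE cjordan_posE /crestr0 mem_set.
Qed.

Let deficitE A : measurable A -> deficit A = nu (A `&` N) - mu (A `&` N).
Proof.
move=> mA; rewrite /deficit jordan_negE cjordan_negE /crestr0 mem_set//.
rewrite /crestr/= /cadd/= /copp/= oppeD ?oppeK; first by rewrite addeC.
by rewrite fin_num_adde_defr// fin_num_measure//; exact: measurableI.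
Qed.

Let splitPN (m : probability X R) A : measurable A ->
  m A = m (A `&` P) + m (A `&` N).
Proof.
case: diffPN => _ _ PN PN0 mA.
have mAP : measurable (A `&` P) by exact: measurableI.
have mAN : measurable (A `&` N) by exact: measurableI.
by rewrite -(measureU m mAP mAN) -?setIUr ?PN ?setIT// setIACA PN0 setI0.
Qed.

Lemma common_part_excess A : measurable A ->
  common_part A + excess A = mu A.
Proof.
move=> mA; rewrite /common_part /= measure_addE excessE// (splitPN mu _ mA)/=.
rewrite /mrestr addeC [nu _ + _]addeC addeA addeAC subeK//.
by rewrite fin_num_measure//; exact: measurableI.
Qed.

Lemma common_part_deficit A : measurable A ->
  common_part A + deficit A = nu A.
Proof.
move=> mA; rewrite /common_part /= measure_addE deficitE// (splitPN nu _ mA)/=.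
rewrite /mrestr -addeA [mu _ + _]addeC subeK//.
by rewrite fin_num_measure//; exact: measurableI.
Qed.

Lemma excess_setT : excess setT = mu P - nu P.
Proof. by rewrite excessE// setTI. Qed.

(** The excess and the deficit have the same mass because [mu] and [nu] have
    the same mass and share the common part. *)
Lemma deficit_setT : deficit setT = mu P - nu P.
Proof.
have : common_part setT + excess setT = common_part setT + deficit setT.
  by rewrite common_part_excess// common_part_deficit// !probability_setT.
have cfin : common_part setT \is a fin_num.
  rewrite ge0_fin_numE//; apply: (@le_lt_trans _ _ (mu setT)).
    by rewrite -common_part_excess// leeDl.
  by rewrite probability_setT ltry.
move=> /(congr1 (fun x => x - common_part setT)).
by rewrite !(addeC (common_part _)) !addeK// excess_setT.
Qed.

Let t : R := fine (excess setT).
Let tE : excess setT = t%:E.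
Proof. by rewrite /t fineK// fin_num_measure. Qed.
Let tV0 : (0 <= t^-1)%R. Proof. by rewrite invr_ge0 -lee_fin -tE. Qed.
Let deficitT : deficit setT = t%:E.
Proof. by rewrite deficit_setT -excess_setT. Qed.

(* This also holds when [t = 0], where [mu] and [nu] agree: both sides vanish,
   since the excess is then the zero measure. *)
Let scale_excess A : measurable A ->
  (t^-1)%:E * (excess A * t%:E) = excess A.
Proof.
move=> mA; have [tz|tn0] := eqVneq t 0%R; last first.
  by rewrite [_ * t%:E]muleC muleA -EFinM mulVf// mul1e.
suff -> : excess A = 0 by rewrite mul0e mule0.
apply/eqP; rewrite eq_le measure_ge0 andbT.
apply: (@le_trans _ _ (excess setT)); last by rewrite tE tz.
by rewrite le_measure// inE.
Qed.

Let scale_deficit A : measurable A ->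
  (t^-1)%:E * (t%:E * deficit A) = deficit A.
Proof.
move=> mA; have [tz|tn0] := eqVneq t 0%R; last first.
  by rewrite muleA -EFinM mulVf// mul1e.
suff -> : deficit A = 0 by rewrite !mule0.
apply/eqP; rewrite eq_le measure_ge0 andbT.
apply: (@le_trans _ _ (deficit setT)); last by rewrite deficitT tz.
by rewrite le_measure// inE.
Qed.

Let measurable_diag : measurable_fun [set: X] (fun x => (x, x)).
Proof. exact: measurable_fun_pair. Qed.

(** The image of the common part under [x |-> (x, x)]. *)
Definition diagonal_part : set (X * X)%type -> \bar R :=
  pushforward common_part (fun x => (x, x)).

Let diagonal_part0 : diagonal_part set0 = 0.
Proof. exact: measure0. Qed.

Let diagonal_part_ge0 A : 0 <= diagonal_part A.
Proof. exact: measure_ge0. Qed.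

Let diagonal_part_sigma_additive : semi_sigma_additive diagonal_part.
Proof. exact: measure_semi_sigma_additive. Qed.

HB.instance Definition _ := isMeasure.Build _ _ _ diagonal_part
  diagonal_part0 diagonal_part_ge0 diagonal_part_sigma_additive.

Let productE A B : measurable A -> measurable B ->
  (excess \x deficit) (A `*` B) = excess A * deficit B.
Proof. exact: product_measure1E. Qed.

(** The common part does not move, and the excess is sent to the deficit
    independently; the factor [t^-1] normalizes the product.  When [t = 0] the
    convention [0^-1 = 0] removes the second term, as it should. *)
Definition maximal_coupling : set (X * X)%type -> \bar R :=
  measure_add diagonal_part
    (mscale (NngNum tV0) (excess \x deficit)).
HB.instance Definition _ := Measure.on maximal_coupling.

Lemma maximal_coupling_fst A : measurable A ->
  pushforward maximal_coupling fst A = mu A.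
Proof.
move=> mA; rewrite /pushforward /maximal_coupling /= measure_addE /=.
rewrite /mscale /= /diagonal_part /pushforward.
rewrite (_ : fst @^-1` A = A `*` setT); last by apply/seteqP; split => [z|z []].
rewrite productE// deficitT scale_excess//.
rewrite (_ : _ @^-1` _ = A); last by apply/seteqP; split => [z []|z].
exact: common_part_excess.
Qed.

Lemma maximal_coupling_snd A : measurable A ->
  pushforward maximal_coupling snd A = nu A.
Proof.
move=> mA; rewrite /pushforward /maximal_coupling /= measure_addE /=.
rewrite /mscale /= /diagonal_part /pushforward.
rewrite (_ : snd @^-1` A = setT `*` A); last by apply/seteqP; split => [z|z []].
rewrite productE// tE scale_deficit//.
rewrite (_ : _ @^-1` _ = A); last by apply/seteqP; split => [z []|z].
exact: common_part_deficit.
Qed.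

Lemma maximal_coupling_setT : maximal_coupling setT = 1.
Proof. by rewrite -(probability_setT mu) -maximal_coupling_fst. Qed.

HB.instance Definition _ := Measure_isProbability.Build _ _ _
  maximal_coupling maximal_coupling_setT.

(** The maximal coupling charges the complement of the diagonal with mass at
    most [mu P - nu P], stated through functions vanishing on the diagonal so
    that the diagonal itself need not be measurable. *)
Lemma maximal_coupling_integral_le (f : (X * X)%type -> \bar R) (M : R) :
  measurable_fun [set: X * X] f ->
  (forall z, 0 <= f z <= M%:E) -> (forall x, f (x, x) = 0) ->
  \int[maximal_coupling]_z f z <= M%:E * (mu P - nu P).
Proof.
move=> mf f0M fd.
have f0 z : 0 <= f z by have /andP[] := f0M z.
rewrite /maximal_coupling ge0_integral_measure_add//.
rewrite ge0_integral_pushforward//.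
rewrite integral0_eq ?add0e; last by move=> x _ /=; rewrite fd.
rewrite ge0_integral_mscale//= -excess_setT.
have : \int[excess \x deficit]_x f x <= M%:E * (t%:E * t%:E).
  rewrite -{1}tE -deficitT -productE// setXTT -integral_cst//.
  by apply: ge0_le_integral => // x _; have /andP[] := f0M x.
move=> le_prod.
apply: (@le_trans _ _ ((t^-1)%:E * (M%:E * (t%:E * t%:E)))).
  by rewrite lee_wpmul2l// lee_fin.
by rewrite muleCA -{1}tE scale_excess.
Qed.

End maximal_coupling.

(** * Bounds on the Wasserstein distance *)

Section coupling_bounds.
Context {R : realType} {T : pmetricType R}.
Implicit Types mu nu : probability (borel T) R.

Lemma wasserstein_dist_le_coupling mu nu J : coupling mu nu J ->
  wasserstein_dist mu nu <= \int[J]_z (mdist (z.1 : T) (z.2 : T))%:E.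
Proof.
by move=> Jc; apply: ereal_inf_lbound; exists J; rewrite // unlock.
Qed.

Lemma diam_ge0 : 0 <= diam T.
Proof.
by apply: ereal_sup_ubound; exists (point, point); rewrite //= mdistxx.
Qed.

Lemma min_dist_ge0 : 0 <= min_dist T.
Proof.
by apply: le_ereal_inf_tmp => _ [z _ <-]; rewrite lee_fin mdist_ge0.
Qed.

Lemma wasserstein_dist_le_diam mu nu : separable_space T ->
  diam T != +oo ->
  wasserstein_dist mu nu <= diam T * total_variation_dist mu nu.
Proof.
move=> sepT Dy.
have [M ME] : exists M, diam T = M%:E.
  by exists (fine (diam T)); rewrite fineK// ge0_fin_numE ?diam_ge0// ltey.
have [P [N PN]] := Hahn_decomposition
  (cadd (charge_of_finite_measure mu) (copp (charge_of_finite_measure nu))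
    : {charge set (borel T) -> \bar R}).
have mP : measurable P by case: PN => -[].
have /wasserstein_dist_le_coupling : coupling mu nu (maximal_coupling PN).
  by move=> A mA; split;
    [exact: maximal_coupling_fst|exact: maximal_coupling_snd].
move=> /le_trans; apply.
apply: (@le_trans _ _ (M%:E * (mu P - nu P))).
  apply: maximal_coupling_integral_le => [|z|x].
  - by apply/measurable_EFinP; exact: measurable_mdist.
  - rewrite lee_fin mdist_ge0/= -ME.
    by apply: ereal_sup_ubound; exists z.
  - by rewrite /= mdistxx.
rewrite ME lee_wpmul2l// -?ME ?diam_ge0//.
apply: (le_trans (lee_abs _)).
by apply: ereal_sup_ubound; exists P.
Qed.

(** With [a], [b], [c] the masses of [A `*` A], [A `*` ~` A] and [~` A `*` A],
    the marginals of [A] are [a + b] and [a + c], and [`|b - c| <= b + c]. *)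
Lemma marginal_gap_le mu nu J (A : set (borel T)) : coupling mu nu J ->
  measurable A -> `|mu A - nu A| <= J ((A `*` ~` A) `|` (~` A `*` A)).
Proof.
move=> Jc mA; have mAC : measurable (~` A) by exact: measurableC.
have [<- <-] := Jc A mA.
have JU (B C : set (borel T * borel T)) : measurable B -> measurable C ->
    B `&` C = set0 -> J (B `|` C) = J B + J C by exact: measureU.
rewrite /pushforward.
rewrite (_ : fst @^-1` A = (A `*` A) `|` (A `*` ~` A)); last first.
  apply/seteqP; split => [[x y] /= Ax|[x y] [] []//].
  by have [|] := pselect (A y); [left|right].
rewrite (_ : snd @^-1` A = (A `*` A) `|` (~` A `*` A)); last first.
  apply/seteqP; split => [[x y] /= Ay|[x y] [] []//].
  by have [|] := pselect (A x); [left|right].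
rewrite !JU; try exact: measurableX;
  try by apply/seteqP; split => // -[x y] /= [] [? ?] [].
have JE (B C : set (borel T)) : measurable B -> measurable C ->
    exists2 r : R, (0 <= r)%R & J (B `*` C) = r%:E.
  move=> mB mC; have mBC := measurableX mB mC.
  exists (fine (J (B `*` C))); first exact: fine_ge0.
  by rewrite fineK// fin_num_measure.
have [a a0 ->] := JE _ _ mA mA.
have [b b0 ->] := JE _ _ mA mAC.
have [c c0 ->] := JE _ _ mAC mA.
rewrite -!EFinD abse_EFin lee_fin ler_norml.
by apply/andP; split; lra.
Qed.

Lemma min_dist_measure_le (J : probability (borel T * borel T)%type R)
    (B : set (borel T * borel T)) :
  separable_space T -> measurable B -> (forall z, B z -> z.1 <> z.2) ->
  min_dist T * J B <= \int[J]_z (mdist (z.1 : T) (z.2 : T))%:E.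
Proof.
move=> sepT mB Bne.
have mdT : measurable_fun [set: borel T * borel T]
    (fun z => (mdist (z.1 : T) (z.2 : T))%:E).
  by apply/measurable_EFinP; exact: measurable_mdist.
rewrite -integral_cst//.
apply: (@le_trans _ _ (\int[J]_(z in B) (mdist (z.1 : T) (z.2 : T))%:E)).
  apply: ge0_le_integral => //.
  - by move=> z _; exact: min_dist_ge0.
  - exact: measurable_funTS.
  - by move=> z Bz; apply: ereal_inf_lbound; exists z => //; exact: Bne.
apply: ge0_subset_integral => //.
by move=> z _; rewrite lee_fin mdist_ge0.
Qed.

(** Two distinct points make [min_dist T] finite, since it is the infimum of a
    nonempty set of reals; when it is [0] the bound is trivial. *)
Lemma min_dist_le_wasserstein mu nu : separable_space T ->
  (exists x y : T, x <> y) ->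
  min_dist T * total_variation_dist mu nu <= wasserstein_dist mu nu.
Proof.
move=> sepT [x [y xy]].
have [m mE] : exists m, min_dist T = m%:E.
  exists (fine (min_dist T)); rewrite fineK// ge0_fin_numE ?min_dist_ge0//.
  apply: (@le_lt_trans _ _ (mdist x y)%:E); last exact: ltry.
  by apply: ereal_inf_lbound; exists (x, y).
have m0 : (0 <= m)%R by rewrite -lee_fin -mE min_dist_ge0.
apply: le_ereal_inf_tmp => _ [J Jc <-]; rewrite unlock.
have [mz|mn0] := eqVneq m 0%R.
  rewrite mE mz mul0e; apply: integral_ge0 => z _.
  by rewrite lee_fin mdist_ge0.
have mp : (0 < m)%R by rewrite lt_neqAle eq_sym mn0.
rewrite mE muleC -lee_pdivlMr//.
apply: ge_ereal_sup => _ [A mA <-].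
rewrite lee_pdivlMr// muleC.
pose B := (A `*` ~` A) `|` (~` A `*` A).
apply: le_trans (min_dist_measure_le J B sepT _ _).
- by rewrite mE lee_wpmul2l//; exact: marginal_gap_le.
- by apply: measurableU; apply: measurableX => //; exact: measurableC.
- by move=> z [[Az nAz]|[nAz Az]] zz; rewrite zz in Az nAz *.
Qed.

End coupling_bounds.

Theorem theorem4 (R : realType) (T : pmetricType R)
    (sepT : separable_space T) :
  (forall mu nu : probability (borel T) R,
     wasserstein_dist mu nu <=
       if diam T == +oo then +oo else diam T * total_variation_dist mu nu)
  /\
  (finite_set [set: T] -> (exists x y : T, x <> y) ->
   forall mu nu : probability (borel T) R,
     min_dist T * total_variation_dist mu nu <= wasserstein_dist mu nu).
Proof.
split=> [mu nu|_ T2 mu nu]; last exact: min_dist_le_wasserstein.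
by case: ifPn => [_|Dy]; [exact: leey|exact: wasserstein_dist_le_diam].
Qed.
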